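(* Let $G$ be a finite connected graph, let $t>0$, let $X$ be an optimal Lipschitz function on $G$ (with respect to $t$), and let $w_0,w_1,\ldots,w_k$ ($k\ge1$) be a hair of $G$. Let $m=\min_{0\le i\le k}X(w_i)$ and $M=\max_{0\le i\le k}X(w_i)$. If $G$ has vertices $u_1,\ldots,u_{M-m-1}$ such that $X(u_i)=m+i$ for each $i$ and $\{u_1,\ldots,u_{M-m-1}\}\cap\{w_1,\ldots,w_k\}=\emptyset$, then $X(w_i)-X(w_{i-1})=X(w_{i'})-X(w_{i'-1})$ for all $1\le i,i'\le k$.
   Context: A function $X:V(G)\to\mathbb{R}$ is Lipschitz if $|X(u)-X(v)|\le d_G(u,v)$ for all vertices $u,v$, where $d_G$ is the graph distance; it is treated as a random variable by placing the uniform distribution on $V(G)$. The log-moment function of $X$ is $L_X(t)=\ln\mathbb{E}\big(e^{t(X-\mathbb{E}X)}\big)$, and $L_G(t)=\max_XL_X(t)$ over Lipschitz functions $X$ on $V(G)$. For fixed $t>0$, a Lipschitz function $X$ is optimal if $L_X(t)=L_G(t)$. (For an optimal $X$ all differences of values of $X$ are integers, so $M-m$ is an integer.) $N(v)$ is the set of neighbours of $v$. A hair of $G$ is a sequence of vertices $w_0,w_1,\ldots,w_k$ such that $N(w_i)=\{w_{i-1},w_{i+1}\}$ for $1\le i\le k-1$ and $N(w_k)=\{w_{k-1}\}$.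
   Formalization: The vertices w_0,…,w_k of the hair are required to be distinct; without this the claim fails, e.g. for the sequence a,b,a in the graph with single edge ab and X(a)=0, X(b)=1. *)

(* Defs.v *)
From mathcomp Require Import all_boot all_order all_algebra.
From mathcomp Require Import all_classical all_reals all_analysis.

Set Implicit Arguments.
Unset Strict Implicit.
Unset Printing Implicit Defensive.

Import Order.TTheory GRing.Theory Num.Theory.
Local Open Scope classical_set_scope.
Local Open Scope ring_scope.

Section Graph.
Context (V : finType) (e : rel V).

Definition simple_graph : Prop := symmetric e /\ irreflexive e.

Definition connected_graph : Prop := forall u v : V, connect e u v.

Definition walk_of_length (u v : V) (n : nat) : bool :=
  [exists p : n.-tuple V, path e u p && (last u p == v)].

(* The value is #|V| when v is not reachable from u; otherwise the shortest
   walk has length less than #|V|, so the bound on n loses nothing (see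
   [gdist_walk] and [gdist_min]). *)
Definition gdist (u v : V) : nat :=
  \big[minn/#|V|]_(n < #|V| | walk_of_length u v n) n.

Lemma gdist_min (u v : V) (p : seq V) :
  path e u p -> last u p = v -> (gdist u v <= size p)%N.
Proof.
move=> ep <-{v}; case/shortenP: ep => p' ep' up' sp'.
have szp : (size p' < #|V|)%N.
  by have := max_card (mem (u :: p')); rewrite (card_uniqP up').
have le_p' : (size p' <= size p)%N.
  by apply: uniq_leq_size => //; case/andP: up'.
apply: leq_trans le_p'; rewrite /gdist.
have w : walk_of_length u (last u p') (Ordinal szp).
  by apply/existsP; exists (in_tuple p'); rewrite /= ep' eqxx.
have: Ordinal szp \in index_enum 'I_#|V| by rewrite mem_index_enum.
elim: (index_enum _) => //= i s IHs; rewrite inE big_cons => /predU1P[<-|/IHs].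
  by rewrite w geq_minl.
by case: ifP => // _; apply: leq_trans; exact: geq_minr.
Qed.

Lemma gdist_walk (u v : V) : connect e u v -> walk_of_length u v (gdist u v).
Proof.
case/connectP=> p ep ->.
have lt : (gdist u (last u p) < #|V|)%N.
  case/shortenP: ep => p' ep' up' _.
  apply: leq_ltn_trans (gdist_min ep' erefl) _.
  by have := max_card (mem (u :: p')); rewrite (card_uniqP up').
move: lt; rewrite /gdist.
elim/big_ind: _ => [|x y Hx Hy|i wi _] //; first by rewrite ltnn.
by rewrite /minn; case: ifP.
Qed.

(* Distinctness of the vertices is part of the notion: otherwise, in a path
   graph, the sequence could reach the other end and fold back on itself,
   e.g. w = a, b, a in the graph with the single edge ab. *)
Definition hair (k : nat) (w : nat -> V) : Prop :=
  [/\ {in [pred i | (i <= k)%N] &, injective w},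
      forall i, (1 <= i < k)%N -> [set x | e (w i) x]%SET = [set w i.-1; w i.+1]%SET
    & [set x | e (w k) x]%SET = [set w k.-1]%SET].

End Graph.

Section LogMoment.
Context (R : realType) (V : finType) (e : rel V).
Implicit Types (X : V -> R) (t : R).

Definition unif_mean X : R := (\sum_(v : V) X v) / #|V|%:R.

Definition lipschitz_fun X : Prop :=
  forall u v : V, `|X u - X v| <= (gdist e u v)%:R.

Definition log_moment X t : R :=
  ln (unif_mean (fun v => expR (t * (X v - unif_mean X)))).

(* The maximum over Lipschitz functions, as a supremum: when the graph is
   connected the set of values is bounded above, see [log_moment_le_graph]
   and [optimalP]. *)
Definition graph_log_moment t : R :=
  sup [set log_moment X t | X in lipschitz_fun].

Definition optimal t X : Prop :=
  lipschitz_fun X /\ log_moment X t = graph_log_moment t.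

Lemma log_moment_le_graph (Y : V -> R) (t : R) : connected_graph e -> 0 < t ->
  lipschitz_fun Y -> log_moment Y t <= graph_log_moment t.
Proof.
move=> e_conn t_gt0 Ylip; apply: ub_le_sup; last by exists Y.
exists (t * #|V|%:R) => _ [X Xlip <-].
have [V0|] := posnP #|V|.
  by rewrite /log_moment {1}/unif_mean V0 invr0 mulr0 ln0 // mulr0.
move=> V_pos; have /card_gt0P[v0 _] := V_pos.
have V_gt0 : (0 : R) < #|V|%:R by rewrite ltr0n.
have sum_const_mean (c : R) : (\sum_(v : V) c) / #|V|%:R = c.
  by rewrite sumr_const -(mulr_natr c) mulfK // gt_eqF.
have mean_gt0 : 0 < unif_mean (fun v => expR (t * (X v - unif_mean X))).
  rewrite divr_gt0 // (bigD1 v0) //= ltr_pwDl ?expR_gt0 //.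
  by apply: sumr_ge0 => v _; exact: expR_ge0.
have dist_le (u v : V) : X u - X v <= #|V|%:R.
  apply: le_trans (ler_norm _) (le_trans (Xlip u v) _); rewrite ler_nat.
  have /connectP[p ep ->] := e_conn u v.
  case/shortenP: ep => p' ep' up' _; apply: leq_trans (gdist_min ep' erefl) _.
  by have := max_card (mem (u :: p')); rewrite (card_uniqP up') => /ltnW.
have dev_le (u : V) : X u - unif_mean X <= #|V|%:R.
  rewrite -[X u]sum_const_mean -[leRHS]sum_const_mean /unif_mean -mulrBl -sumrB.
  by rewrite ler_pM2r ?invr_gt0 //; apply: ler_sum => v _; exact: dist_le.
rewrite -(expRK (t * #|V|%:R)) ler_ln ?posrE ?expR_gt0 //.
rewrite -[leRHS]sum_const_mean ler_pM2r ?invr_gt0 //; apply: ler_sum => v _.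
by rewrite ler_expR ler_pM2l.
Qed.

Lemma optimalP (X : V -> R) (t : R) : connected_graph e -> 0 < t ->
  optimal t X <->
  lipschitz_fun X /\
  (forall Y : V -> R, lipschitz_fun Y -> log_moment Y t <= log_moment X t).
Proof.
move=> e_conn t_gt0; split=> -[Xlip X_max]; split=> //.
  by move=> Y Ylip; rewrite X_max; exact: log_moment_le_graph.
apply/eqP; rewrite eq_le log_moment_le_graph //=.
by apply: ge_sup => [|_ [Y Ylip <-]]; [exists (log_moment X t), X|exact: X_max].
Qed.

End LogMoment.

(* Main.v *)
(* Adding a constant c to X on a tail {w_i, ..., w_k} keeps it Lipschitz as
   soon as the step from w_(i-1) to w_i stays in [-1, 1]. With n = |V|,
   Z = sum_v e^(tX(v)) and T the part of Z carried by the tail, optimality of X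
   says
     Z + (e^(tc) - 1) T <= Z e^(tc(k+1-i)/n).
   Taking c = eps and c = -eps shows that every step is 1 or -1. If the steps
   are not all equal, the hair ends with r >= 1 steps of one sign s, preceded by
   a step of sign -s. Flipping that step (c = 2s) and flipping the next one
   (c = -2s) give two inequalities in a = e^(2st/n) and b = e^(st). Multiplied
   together, they eliminate Z and contradict the strict monotonicity of
     x |-> (1 + x + ... + x^r) / (1 + ... + x^(r-1)),
   provided that n >= 3 and 2r <= n. The hair has at least r+1 vertices besides
   w_0 and spans a range of at least r, so the vertices u_1, ..., u_(r-1) give
   2r <= n; this is the only use of the u_i. *)
Require Import Defs.
From mathcomp Require Import all_boot all_order all_algebra.
From mathcomp Require Import all_classical all_reals all_analysis.
From mathcomp Require Import zify ring lra.

Import Order.TTheory GRing.Theory Num.Theory.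
Local Open Scope ring_scope.

(** * Inequalities over an ordered field *)

(** Cross-multiplied monotonicity of a quotient of consecutive geometric sums. Once the common
    product is cancelled, it holds termwise: [a^j b^i < a^i b^j] for [i < j]. *)
Lemma geom_sum_cross_lt (R : realFieldType) (a b : R) (j : nat) :
  0 < a -> a < b -> (0 < j)%N ->
  (\sum_(i < j.+1) a ^+ i) * (\sum_(i < j) b ^+ i) <
  (\sum_(i < j) a ^+ i) * (\sum_(i < j.+1) b ^+ i).
Proof.
move=> a0 ab j0; have b0 := lt_trans a0 ab.
rewrite !big_ord_recr /= mulrDl mulrDr ltrD2l mulr_sumr mulr_suml.
apply: ltr_sum => [|i _]; first apply/hasP.
  by exists (Ordinal j0); rewrite ?mem_index_enum.
have -> : a ^+ j = a ^+ i * a ^+ (j - i).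
  by rewrite -exprD subnKC // ltnW.
have -> : b ^+ j = b ^+ i * b ^+ (j - i).
  by rewrite -exprD subnKC // ltnW.
rewrite -mulrA ltr_pM2l ?exprn_gt0 // mulrC ltr_pM2l ?exprn_gt0 //.
by rewrite ltrXn2r ?subn_eq0 -?ltnNge ?ltW // nnegrE ltW.
Qed.

(** In the application [A] is the weight [e^(tX)] of the turning vertex, [Z] the total weight and
    [j] the length of the final run. The two alternatives are an increasing and a decreasing run. *)
Lemma turn_contradiction (R : realFieldType) (a b A Z : R) (j : nat) :
  0 < A -> 0 < Z -> (0 < j)%N ->
  [/\ 1 < a, a < b & a ^+ j <= b] \/ [/\ 0 < b, b < a, a < 1 & b <= a ^+ j] ->
  Z + (b ^+ 2 - 1) * (A * \sum_(i < j.+1) b ^+ i) <= Z * a ^+ j.+1 ->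
  Z + ((b ^+ 2)^-1 - 1) * (A * b * \sum_(i < j) b ^+ i) <= Z * (a ^+ j)^-1 ->
  False.
Proof.
move=> A0 Z0 j0 ab.
have a0 : 0 < a by case: ab => [[? ? ?]|[? ? ? ?]]; lra.
have b0 : 0 < b by case: ab => [[? ? ?]|[? ? ? ?]]; lra.
have := subrX1 a j; have := subrX1 a j.+1.
have cross_ab := @geom_sum_cross_lt R a b j a0 ^~ j0.
have cross_ba := @geom_sum_cross_lt R b a j b0 ^~ j0.
have sum_pos (x : R) (n : nat) : 0 < x -> 0 < \sum_(i < n.+1) x ^+ i.
  move=> x0; rewrite big_ord_recl expr0 ltr_wpDr // sumr_ge0 // => i _.
  by rewrite exprn_ge0 // ltW.
have P0 : 0 < \sum_(i < j) a ^+ i by rewrite -(prednK j0) sum_pos.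
have S0 : 0 < \sum_(i < j) b ^+ i by rewrite -(prednK j0) sum_pos.
have p0 : 0 < a ^+ j by rewrite exprn_gt0.
move: cross_ab cross_ba P0 S0 (sum_pos a j a0).
move: ab p0; rewrite exprS.
move: (a ^+ j) (\sum_(i < j) a ^+ i) (\sum_(i < j.+1) a ^+ i) => p P Q.
move: (\sum_(i < j) b ^+ i) (\sum_(i < j.+1) b ^+ i) => S S'.
move=> ab p0 cross_ab cross_ba P0 S0 Q0 eQ eP H1 H2.
have {H1 eQ}H1 : (b ^+ 2 - 1) * (A * S') <= Z * ((a - 1) * Q).
  by rewrite -eQ; lra.
have {H2 eP}H2 : Z * b * ((a - 1) * P) <= (b ^+ 2 - 1) * (A * S * p).
  rewrite -eP -subr_ge0.
  have -> : (b ^+ 2 - 1) * (A * S * p) - Z * b * (p - 1) =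
    p * b * (Z * p^-1 - (Z + ((b ^+ 2)^-1 - 1) * (A * b * S))).
    by field; rewrite !gt_eqF.
  by rewrite mulr_ge0 ?subr_ge0 // ltW // mulr_gt0.
(* With the factors [b P] and [Q], both inequalities contain [Z b (a - 1) P Q] and chain through it,
   which removes [Z]. *)
have {}H1 := ler_wpM2l (ltW (mulr_gt0 b0 P0)) H1.
have {}H2 := ler_wpM2l (ltW Q0) H2.
have H : (b ^+ 2 - 1) * (A * (b * (P * S') - p * (Q * S))) <= 0 by lra.
(* In either case [b P S' - p Q S] has the same strict sign as [b^2 - 1], so the product in [H] is
   positive. *)
case: ab => [[a1 ltab pb]|[_ ltba a1 pb]]; move: H; apply/negP; rewrite -ltNge.
- have pos : 0 < b ^+ 2 - 1 by nra.
  rewrite pmulr_rgt0 // pmulr_rgt0 // subr_gt0.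
  apply: (@le_lt_trans _ _ (b * (Q * S))).
    by rewrite ler_wpM2r // ltW // mulr_gt0.
  by rewrite ltr_pM2l // cross_ab.
- have neg : b ^+ 2 - 1 < 0 by nra.
  rewrite nmulr_rgt0 // pmulr_rlt0 // subr_lt0.
  apply: (@lt_le_trans _ _ (b * (Q * S))).
    by rewrite ltr_pM2l // mulrC (mulrC Q) cross_ba.
  by rewrite ler_wpM2r // ltW // mulr_gt0.
Qed.

(** The two inequalities bound [r (q - 1) T] from above by [r Z (r - 1)] and from below by
    [q Z (r - 1)], which forces [q <= r]. *)
Lemma tight_contradiction (R : realFieldType) (q r T Z : R) :
  0 < T -> 0 < Z -> 1 < r -> r < q ->
  Z + (q - 1) * T <= Z * r -> Z + (q^-1 - 1) * T <= Z * r^-1 -> False.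
Proof.
move=> T0 Z0 r1 rq H1 H2.
have r0 : 0 < r by lra.
have q0 : 0 < q by lra.
have {}H2 : q * (Z * (r - 1)) <= r * ((q - 1) * T).
  rewrite -subr_ge0.
  have -> : r * ((q - 1) * T) - q * (Z * (r - 1)) =
    q * r * (Z * r^-1 - (Z + (q^-1 - 1) * T)) by field; rewrite !gt_eqF.
  by rewrite mulr_ge0 ?subr_ge0 // ltW // mulr_gt0.
have {}H1 : r * ((q - 1) * T) <= r * (Z * (r - 1)).
  by apply: ler_wpM2l; [exact: ltW | lra].
have := le_trans H2 H1; rewrite ler_pM2r ?mulr_gt0 ?subr_gt0 //; lra.
Qed.

(** * Shifting an optimal function on a set of vertices *)

Section OptimalShift.
Context (R : realType) (V : finType) (e : rel V).
Context (e_conn : connected_graph e).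
Implicit Types (X : V -> R) (t : R).

Lemma lipschitz_edge X u v : lipschitz_fun e X -> e u v -> `|X u - X v| <= 1.
Proof.
move=> Xlip euv; apply: le_trans (Xlip u v) _.
by rewrite -[leRHS]/(1%:R) ler_nat (@gdist_min _ _ _ _ [:: v]) //= euv.
Qed.

Lemma edge_lipschitz X :
  (forall u v, e u v -> `|X u - X v| <= 1) -> lipschitz_fun e X.
Proof.
move=> Xe u v.
have /existsP[p /andP[ep /eqP pv]] := gdist_walk (e_conn u v).
suff path_bound x s : path e x s -> `|X x - X (last x s)| <= (size s)%:R.
  by have := path_bound _ _ ep; rewrite pv size_tuple.
elim: s x => [|y s IHs] x /=; first by rewrite subrr normr0.
move=> /andP[exy /IHs ys]; apply: le_trans (ler_distD (X y) _ _) _.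
by rewrite -natr1 addrC lerD // Xe.
Qed.

Lemma sum_expR_gt0 t X (v0 : V) : 0 < \sum_v expR (t * X v).
Proof.
by rewrite (bigD1 v0) //= ltr_pwDl ?expR_gt0 // sumr_ge0.
Qed.

(** The shift multiplies the weights on [S] by [e^(tc)] and moves the mean by [c |S| / n]. The bound
    is the comparison of log-moments with the logarithm and the means cleared. *)
Lemma optimal_shift t X (S : {set V}) (c : R) : 0 < t -> optimal e t X ->
  lipschitz_fun e (fun v => X v + (if v \in S then c else 0)) ->
  \sum_v expR (t * X v) + (expR (t * c) - 1) * (\sum_(v in S) expR (t * X v))
    <= (\sum_v expR (t * X v)) * expR (t * c * #|S|%:R / #|V|%:R).
Proof.
move=> t0 /(optimalP _ e_conn t0)[_ Xmax] Ylip.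
(* On an empty vertex set both sides are [0]. *)
have [/card0_eq V0|V_pos] := posnP #|V|.
  rewrite !big1 ?mulr0 ?addr0 ?mul0r // => v; by have := V0 v.
have n0 : (0 : R) < #|V|%:R by rewrite ltr0n.
set Y := fun v => _ in Ylip.
have Zpos (Z : V -> R) : 0 < \sum_v expR (t * Z v).
  by have /card_gt0P[v0 _] := V_pos; exact: sum_expR_gt0.
have logE (Z : V -> R) : unif_mean (fun v => expR (t * (Z v - unif_mean Z))) =
    (\sum_v expR (t * Z v)) * expR (- (t * unif_mean Z)) / #|V|%:R.
  rewrite {1}/unif_mean; congr (_ / _); rewrite mulr_suml.
  by apply: eq_bigr => v _; rewrite mulrBr expRD.
have := Xmax _ Ylip; rewrite /log_moment ler_ln ?posrE; first last.
- by rewrite logE divr_gt0 // mulr_gt0 ?expR_gt0.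
- by rewrite logE divr_gt0 // mulr_gt0 ?expR_gt0.
rewrite !logE ler_pM2r ?invr_gt0 //.
have meanY : unif_mean Y = unif_mean X + c * #|S|%:R / #|V|%:R.
  rewrite /unif_mean /Y big_split /= -big_mkcond /= sumr_const mulrDl.
  by rewrite -(mulr_natr c).
have sumY : \sum_v expR (t * Y v) = \sum_v expR (t * X v) +
    (expR (t * c) - 1) * (\sum_(v in S) expR (t * X v)).
  rewrite mulr_sumr [X in _ + X]big_mkcond -big_split /=; apply: eq_bigr => v _.
  rewrite /Y; case: ifP => _; last by rewrite !addr0.
  by rewrite mulrDr expRD; ring.
rewrite meanY sumY => H.
rewrite -(ler_pM2r (expR_gt0 (- (t * (unif_mean X + c * #|S|%:R / #|V|%:R))))).
apply: (le_trans H); rewrite -[leRHS]mulrA -expRD.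
rewrite le_eqVlt; apply/orP; left; apply/eqP.
by congr (_ * expR _); ring.
Qed.

(** * Tails of a hair *)

Section HairTail.
Context (k : nat) (w : nat -> V).
Context (w_hair : hair e k w).

Definition hair_tail (i : nat) : {set V} :=
  [set v | v \in map w (index_iota i k.+1)]%SET.

Lemma hair_tailP i v :
  reflect (exists2 l, (i <= l <= k)%N & v = w l) (v \in hair_tail i).
Proof.
rewrite inE; apply: (iffP mapP) => [[l]|[l lk ->]].
  by rewrite mem_index_iota ltnS => lk ->; exists l.
by exists l; rewrite // mem_index_iota ltnS.
Qed.

Lemma hair_map_uniq (s : seq nat) :
  uniq s -> {in s, forall l, (l <= k)%N} -> uniq (map w s).
Proof.
have [w_inj _ _] := w_hair.
by move=> us sk; rewrite map_inj_in_uniq // => x y /sk xk /sk yk; exact: w_inj.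
Qed.

Lemma hair_tail_uniq i : uniq (map w (index_iota i k.+1)).
Proof.
by apply: hair_map_uniq (iota_uniq _ _) _ => l; rewrite mem_index_iota; lia.
Qed.

Lemma card_hair_tail i : #|hair_tail i| = (k.+1 - i)%N.
Proof.
by rewrite cardsE (card_uniqP (hair_tail_uniq i)) size_map size_iota.
Qed.

Lemma sum_hair_tail (F : V -> R) i :
  \sum_(v in hair_tail i) F v = \sum_(i <= l < k.+1) F (w l).
Proof.
rewrite -(big_map w xpredT F) big_uniq ?hair_tail_uniq //.
by apply: eq_bigl => v; rewrite inE.
Qed.

(** For [l >= 1] every neighbour of [w l] lies on the hair, so a tail can be left only backwards
    from its first vertex. The bound [1 <= i] keeps out [w 0], whose other neighbours are
    arbitrary. *)
Lemma hair_tail_boundary i u v : symmetric e -> (1 <= i)%N -> e u v ->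
  u \in hair_tail i -> v \notin hair_tail i -> u = w i /\ v = w i.-1.
Proof.
move=> e_sym i1 euv /hair_tailP[l /andP[il lk] ul] vN; subst u.
have [_ w_mid w_end] := w_hair.
have vN' l' : (i <= l' <= k)%N -> v <> w l'.
  by move=> l'k vl'; case/hair_tailP: vN; exists l'.
have : v \in [set x | e (w l) x]%SET by rewrite inE.
have lE : v = w l.-1 -> w l = w i /\ v = w i.-1.
  move=> vl; have [<-//|l_neq_i] := eqVneq l i.
  by case: (vN' l.-1) => //; lia.
have [lltk|] := ltnP l k.
  rewrite w_mid; last by lia.
  by rewrite !inE => /orP[] /eqP // vl; case: (vN' l.+1) => //; lia.
move=> kl; have -> : l = k by lia.
by rewrite w_end inE => /eqP; have <- : l = k by lia.
Qed.

(** Lipschitz continuity need only be checked on edges, and the single edge joining the tail to the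
    rest is the only one whose difference changes. *)
Lemma shift_tail_lipschitz X i (c : R) : symmetric e -> lipschitz_fun e X ->
  (1 <= i)%N -> `|X (w i) - X (w i.-1) + c| <= 1 ->
  lipschitz_fun e (fun v => X v + (if v \in hair_tail i then c else 0)).
Proof.
move=> e_sym Xlip i1 wc; apply: edge_lipschitz => u v euv.
have Xuv := lipschitz_edge _ _ _ Xlip euv.
case: ifPn => ui; case: ifPn => vi; rewrite ?addr0 //.
- by rewrite [X in `|X|](_ : _ = X u - X v) //; ring.
- have [-> ->] := hair_tail_boundary _ _ _ e_sym i1 euv ui vi.
  by rewrite addrAC.
- rewrite e_sym in euv.
  have [-> ->] := hair_tail_boundary _ _ _ e_sym i1 euv vi ui.
  by rewrite distrC addrAC.
Qed.

Lemma optimal_shift_tail t X i (c : R) :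
  symmetric e -> 0 < t -> optimal e t X ->
  (1 <= i)%N -> `|X (w i) - X (w i.-1) + c| <= 1 ->
  \sum_v expR (t * X v) +
    (expR (t * c) - 1) * (\sum_(i <= l < k.+1) expR (t * X (w l))) <=
  (\sum_v expR (t * X v)) * expR (t * c * (k.+1 - i)%:R / #|V|%:R).
Proof.
move=> e_sym t0 Xopt i1 wc.
rewrite -card_hair_tail -(sum_hair_tail (fun v => expR (t * X v))).
apply: optimal_shift => //; apply: shift_tail_lipschitz => //.
by have [] := Xopt.
Qed.

Lemma hair_size : (k < #|V|)%N.
Proof.
by have := max_card (hair_tail 0); rewrite card_hair_tail; lia.
Qed.

(** * Steps of an optimal function along a hair *)

(** A step of absolute value below 1 leaves room to shift the tail both up and down by the slack
    [eps], and the two optimality bounds are incompatible. *)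
Lemma hair_step_tight t X i : symmetric e -> 0 < t -> optimal e t X ->
  (1 <= i <= k)%N -> `|X (w i) - X (w i.-1)| = 1.
Proof.
move=> e_sym t0 Xopt /andP[i1 ik]; apply/eqP; rewrite eq_le.
have [Xlip _] := Xopt; have [_ w_mid w_end] := w_hair.
have ewi : e (w i) (w i.-1).
  suff : w i.-1 \in [set x | e (w i) x]%SET by rewrite inE.
  have [iltk|ki] := ltnP i k; first by rewrite w_mid ?i1 // !inE eqxx.
  by have -> : i = k; [lia|rewrite w_end inE].
rewrite (lipschitz_edge _ _ _ Xlip ewi) /= leNgt; apply/negP => lt1.
pose eps := 1 - `|X (w i) - X (w i.-1)|.
have eps0 : 0 < eps by rewrite subr_gt0.
have n0 : (0 : R) < #|V|%:R by rewrite ltr0n (leq_trans _ hair_size).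
have shift c : `|c| = eps -> `|X (w i) - X (w i.-1) + c| <= 1.
  by move=> cE; apply: le_trans (ler_normD _ _) _; rewrite cE /eps; lra.
have shift_up := @shift eps (gtr0_norm eps0).
have shift_down : `|X (w i) - X (w i.-1) + - eps| <= 1.
  by apply: shift; rewrite normrN gtr0_norm.
have := optimal_shift_tail _ _ _ _ e_sym t0 Xopt i1 shift_up.
have := optimal_shift_tail _ _ _ _ e_sym t0 Xopt i1 shift_down.
rewrite mulrN !mulNr !expRN => H2 H1.
(* The tail is nonempty and, since [i >= 1], misses [w 0]. Its share of the vertices thus lies
   strictly between 0 and 1, giving [1 < r < q] in [tight_contradiction]. *)
have size_gt0 : (0 : R) < (k.+1 - i)%:R / #|V|%:R.
  by apply: divr_gt0; rewrite // ltr0n; lia.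
have size_lt1 : (k.+1 - i)%:R / #|V|%:R < 1 :> R.
  by rewrite ltr_pdivrMr // mul1r ltr_nat; have := hair_size; lia.
have te0 : 0 < t * eps by rewrite mulr_gt0.
apply: (tight_contradiction _ _ _ _ _ _ _ _ _ H1 H2).
- rewrite big_nat_recr /=; last by lia.
  by rewrite ltr_wpDl ?expR_gt0 // sumr_ge0.
- exact: sum_expR_gt0 (w 0).
- by rewrite expR_gt1 -mulrA mulr_gt0.
- by rewrite ltr_expR -mulrA gtr_pMr.
Qed.

(** Keeping the sign [s] as a parameter treats peaks and valleys together. Adding [2 s] from
    [w (k - r)] on flips the step before the run; adding [- 2 s] from the next vertex on flips the
    first step of the run. *)
Lemma hair_no_turn t X r (s : R) : symmetric e -> 0 < t -> optimal e t X ->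
  (0 < r < k)%N -> (2 * r <= #|V|)%N -> `|s| = 1 ->
  X (w (k - r)%N) - X (w (k - r).-1) = - s ->
  (forall l, (l <= r)%N -> X (w (k - r + l)%N) = X (w (k - r)%N) + s * l%:R) ->
  False.
Proof.
move=> e_sym t0 Xopt /andP[r0 rk] rn s1 turn run.
have step : X (w (k - r).+1) - X (w (k - r)%N) = s.
  by rewrite -addn1 run // mulr1 addrC addKr.
have up : `|X (w (k - r)%N) - X (w (k - r).-1) + 2 * s| <= 1.
  by rewrite turn (_ : - s + 2 * s = s) ?s1 //; ring.
have down : `|X (w (k - r).+1) - X (w (k - r).+1.-1) + 2 * - s| <= 1.
  by rewrite /= step (_ : s + 2 * - s = - s) ?normrN ?s1 //; ring.
have i1 : (1 <= k - r)%N by lia.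
have := optimal_shift_tail _ _ _ _ e_sym t0 Xopt (ltn0Sn _) down.
have := optimal_shift_tail _ _ _ _ e_sym t0 Xopt i1 up.
have n3 : (2 < #|V|)%N by have := hair_size; lia.
have n0 : (0 : R) < #|V|%:R by rewrite ltr0n; lia.
(* [b] is the ratio of consecutive weights along the run; [a] is what each vertex of a tail
   contributes to the right-hand side when that tail is shifted by [2 s]. *)
set b := expR (t * s).
set a := expR (2 * (t * s) / #|V|%:R).
have eU (j : nat) : expR (t * (2 * s) * j%:R / #|V|%:R) = a ^+ j.
  by rewrite -expRM_natr; congr expR; field; rewrite gt_eqF.
have eD (j : nat) : expR (t * (2 * - s) * j%:R / #|V|%:R) = (a ^+ j)^-1.
  by rewrite -eU -expRN; congr expR; ring.
have eb : expR (t * (2 * s)) = b ^+ 2.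
  by rewrite -expRM_natr; congr expR; ring.
have ebV : expR (t * (2 * - s)) = (b ^+ 2)^-1.
  by rewrite -eb -expRN; congr expR; ring.
have run_exp l : (l <= r)%N ->
    expR (t * X (w (l + (k - r))%N)) = expR (t * X (w (k - r)%N)) * b ^+ l.
  move=> lr; rewrite addnC run // -expRM_natr -expRD; congr expR; ring.
rewrite eU eD eb ebV.
have -> : (k.+1 - (k - r) = r.+1)%N by lia.
have -> : (k.+1 - (k - r).+1 = r)%N by lia.
have -> : \sum_(k - r <= l < k.+1) expR (t * X (w l)) =
    expR (t * X (w (k - r)%N)) * \sum_(l < r.+1) b ^+ l.
  rewrite -{1}[(k - r)%N]add0n big_addn mulr_sumr.
  have -> : (k.+1 - (k - r) = r.+1)%N by lia.
  by rewrite big_mkord; apply: eq_bigr => l _; rewrite run_exp // -ltnS.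
have -> : \sum_((k - r).+1 <= l < k.+1) expR (t * X (w l)) =
    expR (t * X (w (k - r)%N)) * b * \sum_(l < r) b ^+ l.
  rewrite -{1}[(k - r).+1]add0n big_addn mulr_sumr.
  have -> : (k.+1 - (k - r).+1 = r)%N by lia.
  rewrite big_mkord; apply: eq_bigr => l _.
  by rewrite addnS -addSn run_exp ?exprS ?mulrA.
apply: turn_contradiction => //; [exact: expR_gt0|exact: sum_expR_gt0 (w 0)|].
(* With [q = 2 / n], the exponents of [a], [a^r] and [b] are [t s] times [q], [q r] and 1. So
   [n >= 3] places [a] strictly between 1 and [b], and [2 r <= n] keeps [a^r] from passing [b]. *)
have n3R : (3 : R) <= #|V|%:R by rewrite ler_nat.
have rnR : 2 * r%:R <= #|V|%:R :> R by rewrite -natrM ler_nat.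
have q1 : 2 / #|V|%:R < 1 :> R by rewrite ltr_pdivrMr // mul1r; lra.
have q0 : 0 < 2 / #|V|%:R :> R by rewrite divr_gt0.
have qr : 2 / #|V|%:R * r%:R <= 1 :> R.
  by rewrite mulrAC ler_pdivrMr // mul1r.
have arE : a ^+ r = expR (t * s * (2 / #|V|%:R * r%:R)).
  by rewrite -expRM_natr; congr expR; ring.
have aE : a = expR (t * s * (2 / #|V|%:R)) by congr expR; ring.
rewrite arE {}aE /b !expR_gt0 !expR_gt1 expR_lt1 !ltr_expR !ler_expR.
move: (2 / _) q0 q1 qr => q q0 q1 qr.
have [sE|sE] : s = 1 \/ s = -1.
  by move/eqP: s1; rewrite eqr_norml ler01 andbT => /orP[] /eqP; [left|right].
- left; rewrite sE !mulr1; split; first exact: mulr_gt0.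
    by rewrite gtr_pMr.
  by rewrite ger_pMr.
- right; rewrite sE mulrN1; split=> //.
  + by rewrite mulNr ltrN2 gtr_pMr.
  + by rewrite mulNr oppr_lt0 mulr_gt0.
  + by rewrite mulNr lerN2 ger_pMr.
Qed.

End HairTail.

End OptimalShift.

(** * Equality of the steps, by counting vertices *)

Theorem lemma2p10 (R : realType) (V : finType) (e : rel V)
    (e_simple : simple_graph e) (e_conn : connected_graph e)
    (t : R) (t_gt0 : 0 < t) (X : V -> R) (X_opt : optimal e t X)
    (k : nat) (k_ge1 : (1 <= k)%N) (w : nat -> V) (w_hair : hair e k w)
    (m M : R)
    (m_def : m = \big[Num.min/X (w 0%N)]_(0 <= i < k.+1) X (w i))
    (M_def : M = \big[Num.max/X (w 0%N)]_(0 <= i < k.+1) X (w i))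
    (u_ex : exists u : nat -> V, forall i : nat,
       (1 <= i)%N -> i%:R <= M - m - 1 ->
       X (u i) = m + i%:R /\
       (forall j : nat, (1 <= j <= k)%N -> u i <> w j)) :
  forall i i' : nat, (1 <= i <= k)%N -> (1 <= i' <= k)%N ->
    X (w i) - X (w i.-1) = X (w i') - X (w i'.-1).
Proof.
have [e_sym _] := e_simple.
have hair_min l : (l <= k)%N -> m <= X (w l).
  by move=> lk; rewrite m_def ge_bigmin_seq // mem_index_iota.
have hair_max l : (l <= k)%N -> X (w l) <= M.
  by move=> lk; rewrite M_def le_bigmax_seq // mem_index_iota.
have tight := hair_step_tight _ _ _ e_conn _ _ w_hair _ _ _ e_sym t_gt0 X_opt.
pose step i : R := X (w i) - X (w i.-1).
(* Steps are compared with the last one, by strong induction on the distance [r] from the end of the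
   hair. *)
suff last_step r : (r < k)%N -> step (k - r)%N = step k.
  move=> i i' ik i'k; rewrite -/(step i) -/(step i').
  rewrite -(@subKn i k) ?last_step -1?(@subKn i' k) ?last_step //; lia.
elim/ltn_ind: r => r IHr rk; have [->|r0] := posnP r; first by rewrite subn0.
have sk : `|step k| = 1 by apply: tight; lia.
have /eqP : `|step (k - r)%N| = `|step k| by rewrite sk; apply: tight; lia.
rewrite eqr_norm2 => /orP[/eqP //|/eqP turn].
have run l : (l <= r)%N ->
    X (w (k - r + l)%N) = X (w (k - r)%N) + step k * l%:R.
  elim: l => [|l IHl] lr; first by rewrite addn0 mulr0 addr0.
  have /IHr : (r - l.+1 < r)%N by lia.
  have -> : (k - (r - l.+1) = k - r + l.+1)%N by lia.
  rewrite /step addnS /= => stepE.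
  rewrite -natr1 mulrDr mulr1 addrA -IHl -?stepE; [by ring|lia|lia].
(* Only [2 r <= n] remains to be shown after this. *)
exfalso; apply: (hair_no_turn _ _ _ e_conn _ _ w_hair _ _ r (step k)
  e_sym t_gt0 X_opt _ _ sk turn run); first by rewrite r0.
(* The two ends of the run differ by exactly [r], so [u i] is available for every [1 <= i < r]. *)
have range : r%:R <= M - m.
  have := run r (leqnn r); rewrite subnK; last exact: ltnW.
  have := hair_min (k - r)%N (leq_subr _ _); have := hair_min k (leqnn k).
  have := hair_max (k - r)%N (leq_subr _ _); have := hair_max k (leqnn k).
  by move/eqP: sk; rewrite eqr_norml ler01 andbT => /orP[] /eqP ->; lra.
have [u uP] := u_ex.
have uP' i : (1 <= i < r)%N -> X (u i) = m + i%:R /\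
    forall j, (1 <= j <= k)%N -> u i <> w j.
  move=> /andP[i1 ir]; apply: uP => //.
  have : i.+1%:R <= r%:R :> R by rewrite ler_nat.
  by rewrite -natr1; lra.
have uniq_w : uniq (map w (iota 1 k)).
  apply: hair_map_uniq w_hair _ (iota_uniq _ _) _ => l.
  by rewrite mem_iota; lia.
(* The [u i] are distinct because [X] takes distinct values [m + i] on them. *)
have uniq_u : uniq (map u (iota 1 r.-1)).
  rewrite map_inj_in_uniq ?iota_uniq // => i j.
  rewrite !mem_iota => ir jr uij; apply/eqP; rewrite -(eqr_nat R); apply/eqP.
  have [] := uP' i; first by lia.
  have [] := uP' j; first by lia.
  by rewrite uij => -> _ /addrI ->.
have uniq_uw : uniq (map u (iota 1 r.-1) ++ map w (iota 1 k)).
  rewrite cat_uniq uniq_u uniq_w andbT /=.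
  apply/hasPn => _ /mapP[j jk ->]; apply/mapP => -[i ir] /esym.
  move: jk ir; rewrite !mem_iota => jk ir.
  by have [] := uP' i; [lia|move=> _; apply; lia].
(* There are [(r - 1) + k] distinct vertices, and [k >= r + 1], hence at least [2 r]. *)
have := max_card (mem (map u (iota 1 r.-1) ++ map w (iota 1 k))).
by rewrite (card_uniqP uniq_uw) size_cat !size_map !size_iota; lia.
Qed.
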